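(* For $n\ge 1$, let $c_n(\lambda)$ be the characteristic polynomial of the $n\times n$ matrix $C_n$ whose $(p,q)$ entry is $2^{q-p+2}-1$ if $q\ge p-1$ and $0$ if $q<p-1$; and let $c_0(\lambda)=1$. Then for all $n\ge 1$, $$c_{n}(\lambda) = (3-\lambda)c_{n-1}(\lambda) - \sum_{i=2}^{n}(-1)^{i}(2^{i+1}-1)c_{n-i}(\lambda).$$
   Context: The characteristic polynomial of an $n\times n$ matrix $C_n$ is $\det(C_n-\lambda I)$. Empty sums are $0$. *)

(* Defs.v *)
From mathcomp Require Import all_boot all_order all_algebra.
Set Implicit Arguments.
Unset Strict Implicit.
Unset Printing Implicit Defensive.
Import GRing.Theory.
Local Open Scope ring_scope.

(* Characteristic polynomial with the sign convention det (A - 'X I); it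
   differs from the library's [char_poly A] = det ('X I - A) by (-1) ^ n. *)
Definition charpoly_sub (R : comNzRingType) (n : nat) (A : 'M[R]_n) : {poly R} :=
  \det (map_mx polyC A - 'X%:M).

(* Rows and columns are indexed from 0; the entries only depend on the
   difference of the indices, so the usual formula is unchanged.  The
   subtraction in the exponent is on nat, and exact under the guard. *)
Definition Cmx (n : nat) : 'M[int]_n :=
  \matrix_(p < n, q < n)
    (if (p <= q.+1)%N then 2 ^+ (q + 2 - p)%N - 1 else 0).

Definition c (n : nat) : {poly int} :=
  if n is 0%N then 1 else charpoly_sub (Cmx n).

(* Main.v *)
Require Import Defs.
From mathcomp Require Import all_boot all_order all_algebra.
Set Implicit Arguments.
Unset Strict Implicit.
Unset Printing Implicit Defensive.
Import GRing.Theory.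
Local Open Scope ring_scope.

(** The matrix C_n - λI is Toeplitz and upper Hessenberg with 1 on the
    subdiagonal.  Replace its first row by an arbitrary vector v.  The first
    column then has only the two nonzero entries v_0 and 1; deleting the first
    row leaves the unmodified matrix of size n - 1, and deleting the second one
    leaves a matrix of the same shape whose first row is v shifted by one.
    Iterating yields the expansion of the determinant. *)

(* The entry at (p, q), for p >= 1, is a (q - p + 1); hence a 0 is the
   subdiagonal, and v = a \o S gives the Toeplitz matrix itself. *)
Definition hess_mx (R : nzRingType) (v a : nat -> R) (n : nat) : 'M[R]_n :=
  \matrix_(p < n, q < n)
    (if p : nat is p'.+1 then if (p' <= q)%N then a (q - p')%N else 0 else v q).

Lemma det_hess_mxS (R : comNzRingType) (v a : nat -> R) (n : nat) : a 0%N = 1 ->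
  \det (hess_mx v a n.+2) =
    v 0%N * \det (hess_mx (a \o S) a n.+1) - \det (hess_mx (v \o S) a n.+1).
Proof.
move=> a0; rewrite (expand_det_col _ ord0) !big_ord_recl big1 => [|i _].
  rewrite addr0 !mxE /= a0 mul1r /cofactor /= expr0 expr1 mul1r mulN1r.
  by congr (_ * _ - _); congr (\det _); apply/matrixP=> p q;
    rewrite !mxE //=; case: p => [[|p] ltp].
by rewrite !mxE /= mul0r.
Qed.

(** Each of the [i] shifts of the first row contributes a factor -1 and brings [v i] to the
    front. *)
Lemma det_hess_mx (R : comNzRingType) (v a : nat -> R) (n : nat) : a 0%N = 1 ->
  \det (hess_mx v a n.+1) =
    \sum_(i < n.+1) (-1) ^+ i * v i * \det (hess_mx (a \o S) a (n - i)).
Proof.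
move=> a0; elim: n v => [|n IHn] v.
  by rewrite det_mx11 !mxE big_ord1 det_mx00 mul1r mulr1.
rewrite det_hess_mxS // (IHn (v \o S)) [RHS]big_ord_recl expr0 mul1r subn0 -sumrN.
congr (_ + _); apply: eq_bigr => i _.
by rewrite exprS mulN1r !mulNr.
Qed.

(** Diagonals are counted from the subdiagonal, so [k = 1] is the main one, which carries ['X]. *)
Definition c_coef (k : nat) : {poly int} := 2 ^+ k.+1 - 1 - 'X *+ (k == 1%N).

Lemma c_hess_mx (n : nat) : c n = \det (hess_mx (c_coef \o S) c_coef n).
Proof.
have polyCE k : (2 ^+ k - 1 : int)%:P = 2 ^+ k - 1.
  by rewrite polyCB polyC_exp polyC_natr.
case: n => [|n]; first by rewrite det_mx00.
congr (\det _); apply/matrixP=> p q; rewrite !mxE -val_eqE /c_coef /=.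
case: p q => [[|p] ltp] [q ltq] /=.
  by rewrite subn0 addn2 polyCE eqSS [0%N == q]eq_sym.
rewrite ltnS addn2 subSS; case: leqP => [le_pq|lt_qp].
  rewrite subSn // polyCE; congr (_ - 'X *+ nat_of_bool _).
  by rewrite -(eqn_add2r p (q - p)) subnK // eq_sym.
(* Below the subdiagonal the entry is off the main diagonal, so no ['X] appears. *)
by rewrite gtn_eqF ?subr0 // ltnS ltnW.
Qed.

Theorem corollary5 (n : nat) (hn : (1 <= n)%N) :
  c n = (3 - 'X) * c (n - 1)%N
        - \sum_(2 <= i < n.+1) (-1) ^+ i * (2 ^+ i.+1 - 1) * c (n - i)%N.
Proof.
case: n hn => // n _.
have a0 : c_coef 0%N = 1 by rewrite /c_coef subr0 expr1 -addrA subrr addr0.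
have a1 : c_coef 1%N = 3 - 'X by rewrite /c_coef -natrX -(@natrB _ 4 1).
rewrite c_hess_mx det_hess_mx // big_ord_recl expr0 mul1r subn0 /= a1.
rewrite subn1 -c_hess_mx; congr (_ + _).
(* The sum is shifted by 2, but the remaining expansion terms only by 1: hence the minus sign. *)
rewrite big_add1 big_add1 big_mkord -sumrN; apply: eq_bigr => i _.
by rewrite -c_hess_mx subSS /c_coef /= subr0 [in RHS]exprS mulN1r !mulNr opprK.
Qed.
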